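(* Let $(X,\|\cdot\|)$ be a real Banach space. If $(X,\|\cdot\|)$ is smooth and $N(X)$ is finite, then $(X,\|\cdot\|)$ has the hereditary Mazur intersection property. In particular, $(X,\|\cdot\|)$ is Asplund.
   Context: All Banach spaces are real, and ''subspace'' means closed linear subspace (equipped with the restricted norm). $S(X)=\{x\in X:\|x\|=1\}$ and $X^*$ is the dual of $X$. For $x\in S(X)$, $D_X(x)=\{f\in S(X^* ): f(x)=1\}$; the multivalued map $D_X$ is the duality map. A point $x\in S(X)$ is a smooth point if $D_X(x)$ is a singleton; $X$ is smooth if every $x\in S(X)$ is a smooth point. A point $x\in S(X)$ is a Fréchet smooth point if $D_X$ is single-valued and norm-norm continuous at $x$ (equivalently, the norm is Fréchet differentiable at $x$). $N(X)$ denotes the set of $x\in S(X)$ at which the norm is not Fréchet smooth. A Banach space has the Mazur intersection property (MIP) if every closed, bounded, convex set in it is the intersection of the closed balls containing it. $X$ has the hereditary MIP if $X$ and all its subspaces have MIP. A Banach space is Asplund if every separable subspace of it has separable dual. *)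

(* Defs.v *)
From HB Require Import structures.
From mathcomp Require Import all_boot all_order all_algebra.
From mathcomp Require Import all_classical all_reals all_analysis.

Set Implicit Arguments.
Unset Strict Implicit.
Unset Printing Implicit Defensive.

Import Order.TTheory GRing.Theory Num.Theory.
Import numFieldNormedType.Exports.

Local Open Scope classical_set_scope.
Local Open Scope ring_scope.

Section Subspace.
Context {R : realType} {X : normedModType R}.

Record closed_subspace := ClosedSubspace {
  subspace_set :> set X ;
  subspace_submod : submod_closed (mem subspace_set) ;
  subspace_closed : closed subspace_set }.

Variable Y : closed_subspace.

Definition subspace_pred : {pred X} := mem (subspace_set Y).

HB.instance Definition _ :=
  GRing.isSubmodClosed.Build R X subspace_pred (subspace_submod Y).

Record subspace_type := SubspaceType {
  subspace_val :> X ;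
  _ : subspace_val \in subspace_pred }.

HB.instance Definition _ := [isSub for subspace_val].
HB.instance Definition _ := [Choice of subspace_type by <:].
HB.instance Definition _ := [SubChoice_isSubLmodule of subspace_type by <:].

Let subspace_norm (y : subspace_type) : R := `|val y|.

Let ler_subspace_normD x y :
  subspace_norm (x + y) <= subspace_norm x + subspace_norm y.
Proof. exact: ler_normD. Qed.

Let subspace_normZ (l : R) x :
  subspace_norm (l *: x) = `|l| * subspace_norm x.
Proof. exact: normrZ. Qed.

Let subspace_norm0_eq0 x : subspace_norm x = 0 -> x = 0.
Proof. by move=> /normr0_eq0 x0; apply: val_inj. Qed.

HB.instance Definition _ := Lmodule_isNormed.Build R subspace_type
  ler_subspace_normD subspace_normZ subspace_norm0_eq0.

End Subspace.
Arguments closed_subspace {R} X.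

Section SubspaceComplete.
Context {R : realType} {X : completeNormedModType R} (Y : closed_subspace X).

Let subspace_complete (F : set_system (subspace_type Y)) :
  ProperFilter F -> cauchy F -> cvg F.
Proof.
move=> FF /cauchyP Fc.
have Gc : cauchy (@subspace_val R X Y @ F).
  apply/cauchyP => e e0; have [y Fy] := Fc e e0.
  exists (val y); apply: (@filterS _ F _ _ _ _ Fy) => z /=.
  by rewrite -!ball_normE.
have : cvg (@subspace_val R X Y @ F) by exact: cauchy_cvg.
move=> /cvg_ex[l Gl].
have Yl : subspace_set Y l.
  apply: (closed_cvg (F := F) (subspace_set Y) (@subspace_closed _ _ Y)) Gl.
  by apply: nearW => y; have := valP y; rewrite inE.
apply/cvg_ex; exists (SubspaceType (mem_set Yl)).
apply/cvgrPdist_lt => e e0.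
by have /cvgrPdist_lt/(_ e e0) := Gl.
Qed.

HB.instance Definition _ :=
  Uniform_isComplete.Build (subspace_type Y) subspace_complete.

End SubspaceComplete.

Section Dual.
Context {R : realType} (X : normedModType R).

Definition dual_pred : {pred X -> R^o} :=
  mem [set f : X -> R^o | linear f /\ continuous f].

Let dual_pred_submod : submod_closed dual_pred.
Proof.
split=> [|a f g].
  rewrite inE; split; first by move=> a x y; rewrite /= scaler0 addr0.
  by move=> x; exact: cvg_cst.
rewrite !inE => -[fl fc] [gl gc]; split=> [b x y|x].
  rewrite /= !fctE /= fl gl !scalerDr !scalerA mulrC addrACA.
  by [].
by apply: cvgD; [apply: cvgZl_tmp; exact: fc|exact: gc].
Qed.

HB.instance Definition _ :=
  GRing.isSubmodClosed.Build R (X -> R^o) dual_pred dual_pred_submod.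

Record dual := Dual {
  dual_fun :> X -> R^o ;
  _ : dual_fun \in dual_pred }.

HB.instance Definition _ := [isSub for dual_fun].
HB.instance Definition _ := [Choice of dual by <:].
HB.instance Definition _ := [SubChoice_isSubLmodule of dual by <:].

Definition dual_norm (f : dual) : R :=
  sup [set `|f x| | x in [set x : X | `|x| <= 1]].

Lemma dual_linear (f : dual) : linear f.
Proof. by have := valP f; rewrite inE => -[]. Qed.

Lemma dual_continuous (f : dual) : continuous f.
Proof. by have := valP f; rewrite inE => -[]. Qed.

HB.instance Definition _ (f : dual) :=
  GRing.isLinear.Build R X R^o *:%R f (dual_linear f).

Let dual_has_sup (f : dual) :
  has_sup [set `|f x| | x in [set x : X | `|x| <= 1]].
Proof.
split; first by exists `|f 0|, 0 => //=; rewrite normr0.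
have : bounded_near f (nbhs (0 : X)).
  by apply: continuous_linear_bounded; exact: dual_continuous.
move/bounded_funP => /(_ 1)[M fM].
by exists M => _ [x x1 <-]; exact: fM.
Qed.

Let dual_norm_ub (f : dual) (x : X) : `|x| <= 1 -> `|f x| <= dual_norm f.
Proof. by move=> x1; apply: sup_upper_bound => //; exists x. Qed.

Let dual_norm_le (f : dual) (M : R) :
  (forall x : X, `|x| <= 1 -> `|f x| <= M) -> dual_norm f <= M.
Proof.
move=> fM; apply: ge_sup; first by have [] := dual_has_sup f.
by move=> _ [x x1 <-]; exact: fM.
Qed.

Let ler_dual_normD (f g : dual) : dual_norm (f + g) <= dual_norm f + dual_norm g.
Proof.
apply: dual_norm_le => x x1.
by apply: (le_trans (ler_normD _ _)); rewrite lerD// dual_norm_ub.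
Qed.

Let dual_normZ (l : R) (f : dual) : dual_norm (l *: f) = `|l| * dual_norm f.
Proof.
have le (k : R) (g : dual) : dual_norm (k *: g) <= `|k| * dual_norm g.
  apply: dual_norm_le => x x1.
  by rewrite [leLHS]normrM ler_wpM2l// dual_norm_ub.
apply/eqP; rewrite eq_le le /=.
have [->|l0] := eqVneq l 0.
  rewrite normr0 mul0r scale0r.
  apply: (@le_trans _ _ `|(0 : dual) 0|); first by [].
  by apply: dual_norm_ub; rewrite normr0.
rewrite -ler_pdivlMl ?normr_gt0// -normfV.
by apply: le_trans (le _ _); rewrite scalerA mulVf// scale1r.
Qed.

Let dual_norm0_eq0 (f : dual) : dual_norm f = 0 -> f = 0.
Proof.
move=> f0; apply: val_inj; apply/funext => x /=.
have [->|x0] := eqVneq x 0; first exact: linear0.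
have nx0 : `|x| != 0 by rewrite normr_eq0.
have : `|f (`|x|^-1 *: x)| <= 0.
  by rewrite -f0 dual_norm_ub// normrZ normfV normr_id mulVf.
rewrite normr_le0 linearZ /= => /eqP/(congr1 (fun z => `|x| *: z)).
by rewrite scaler0 scalerA mulfV// scale1r.
Qed.

HB.instance Definition _ := Lmodule_isNormed.Build R dual
  ler_dual_normD dual_normZ dual_norm0_eq0.

End Dual.

Section Notions.
Context {R : realType}.
Implicit Type X : normedModType R.

Definition unit_sphere X : set X := [set x | `|x| = 1].
Arguments unit_sphere : clear implicits.

Definition duality_map X (x : X) : set (dual X) :=
  [set f | unit_sphere (dual X) f /\ f x = 1].

Definition smooth_point X (x : X) :=
  exists f : dual X, duality_map x = [set f].

Definition smooth X := forall x : X, unit_sphere X x -> smooth_point x.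

(* Norm-norm continuity of the set-valued [duality_map] at [x], with value
   [[set f]]: every selection tends to [f] as [y] tends to [x] in the sphere. *)
Definition frechet_smooth_point X (x : X) :=
  exists f : dual X, duality_map x = [set f] /\
    forall e : R, 0 < e ->
      \forall y \near within (unit_sphere X) (nbhs x),
        forall g : dual X, duality_map y g -> `|g - f| < e.

Definition nonfrechet_points X : set X :=
  [set x | unit_sphere X x /\ ~ frechet_smooth_point x].

(* The empty set is excluded: it is not an intersection of balls in the zero
   space. *)
Definition mazur_intersection X := forall C : set X,
  C !=set0 -> closed C -> bounded_set C -> convex_set C ->
  C = \bigcap_(B in [set B : set X |
        (exists (x : X) (r : R), 0 < r /\ B = closed_ball x r) /\ C `<=` B]) B.

Definition hereditary_mazur_intersection X :=
  mazur_intersection X /\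
  forall Y : closed_subspace X, mazur_intersection (subspace_type Y).

Definition separable (T : topologicalType) :=
  exists D : set T, countable D /\ dense D.

Definition asplund X := forall Y : closed_subspace X,
  separable (subspace_type Y) -> separable (dual (subspace_type Y)).

End Notions.
Arguments unit_sphere {R} X.
Arguments nonfrechet_points {R} X.

(* Main.v *)
(** Both conclusions follow from one density statement: every nonzero functional
    is approximated by positive multiples of functionals [g] with
    [D(x) = {g}], [x] a Frechet smooth point. Ekeland's principle applied to
    [|x|^2/2 - f x] gives this without Frechet smoothness (Bishop-Phelps). To
    avoid the finite set [N(X)], perturb [f] along some [g0] not proportional
    to [f]: [f + t g0] lies on a line [R D(x)], [x] in [N(X)], for finitely many
    [t] only, and off these lines a close enough approximation cannot come from
    [N(X)]. If no such [g0] exists, the dual has dimension one and every point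
    is Frechet smooth.

    For the Mazur intersection property, separate [z] from [C] by [f],
    replace [f] by some [g] as above, and use the ball centred at [z + n x]
    with radius slightly less than [n], for [n] large. For Asplundness, [D] maps
    a countable dense set of Frechet smooth points to a set whose rational
    multiples are dense in the dual. Smoothness and finiteness of [N] pass to
    closed subspaces by the Hahn-Banach theorem. *)
From HB Require Import structures.
Require Import Defs.
From mathcomp Require Import all_boot all_order all_algebra.
From mathcomp Require Import all_classical all_reals all_analysis.
From mathcomp Require Import lra.

Set Implicit Arguments.
Unset Strict Implicit.
Unset Printing Implicit Defensive.

Import Order.TTheory GRing.Theory Num.Theory.
Import numFieldNormedType.Exports.

Local Open Scope classical_set_scope.
Local Open Scope ring_scope.

(** * Sublinear functionals and a Mazur-Orlicz form of the Hahn-Banach theorem *)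

Section Sublinear.
Context {R : realType} {V : lmodType R}.
Implicit Types (p q : V -> R) (K : set (V * R)).

Definition sublinear p :=
  (forall x y, p (x + y) <= p x + p y) /\
  (forall t x, 0 < t -> p (t *: x) <= t * p x).

(** A pair [(w, a)] of the convex cone [K] stands for the constraint [a <= f w] on a linear
    functional [f] to be found. *)
Definition cone_set K :=
  [/\ K (0, 0),
      forall v w a b, K (v, a) -> K (w, b) -> K (v + w, a + b) &
      forall t v a, 0 < t -> K (v, a) -> K (t *: v, t * a)].

Lemma sublinear0 p : sublinear p -> p 0 = 0.
Proof.
move=> [_ pZ]; have := pZ 2 0 ltac:(by []); have := pZ 2^-1 0 ltac:(by []).
rewrite !scaler0; lra.
Qed.

Lemma sublinearZ p t x : sublinear p -> 0 <= t -> p (t *: x) = t * p x.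
Proof.
move=> sp; rewrite le_eqVlt => /predU1P[<-|t0].
  by rewrite scale0r mul0r sublinear0.
apply/eqP; rewrite eq_le (proj2 sp)//=.
have := proj2 sp t^-1 (t *: x); rewrite invr_gt0 => /(_ t0).
by rewrite scalerA mulVf ?gt_eqF// scale1r ler_pdivlMl.
Qed.

Lemma sublinear_geN p x : sublinear p -> - p (- x) <= p x.
Proof.
move=> sp; have := proj1 sp x (- x).
by rewrite subrr sublinear0//; lra.
Qed.

(** If [p] is sublinear and [a <= p w] on the cone [K], this is the largest sublinear [q <= p] with
    [q (- w) <= - a] on [K]; a linear functional below it meets every constraint of [K]. *)
Definition inf_along p K v := inf [set p (v + wa.1) - wa.2 | wa in K].

Section InfAlong.
Variables (p : V -> R) (K : set (V * R)).
Hypotheses (sp : sublinear p) (cK : cone_set K).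
Hypothesis pK : forall w a, K (w, a) -> a <= p w.

Let inf_along_lb v : lbound [set p (v + wa.1) - wa.2 | wa in K] (- p (- v)).
Proof.
move=> _ [[w a] /= Kwa <-]; have := proj1 sp (v + w) (- v).
by rewrite addrAC subrr add0r; have := pK Kwa; lra.
Qed.

Lemma inf_along_le v w a : K (w, a) -> inf_along p K v <= p (v + w) - a.
Proof.
move=> Kwa; apply: ge_inf; first by exists (- p (- v)); exact: inf_along_lb.
by exists (w, a).
Qed.

Lemma inf_along_sublinear : sublinear (inf_along p K).
Proof.
have [K0 KD KZ] := cK.
split=> [x y|t x t0].
  rewrite -lerBlDl; apply: lb_le_inf; first by exists (p (y + 0) - 0), (0, 0).
  move=> _ [[w a] /= Kwa <-].
  rewrite lerBlDl -lerBlDr; apply: lb_le_inf.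
    by exists (p (x + 0) - 0), (0, 0).
  move=> _ [[z b] /= Kzb <-]; rewrite lerBlDr.
  apply: (le_trans (inf_along_le _ (KD _ _ _ _ Kzb Kwa))).
  by rewrite addrACA; have := proj1 sp (x + z) (y + w); lra.
rewrite -ler_pdivrMl//; apply: lb_le_inf.
  by exists (p (x + 0) - 0), (0, 0).
move=> _ [[w a] /= Kwa <-]; rewrite ler_pdivrMl//.
apply: (le_trans (inf_along_le _ (KZ _ _ _ t0 Kwa))).
by rewrite -scalerDr mulrBr lerD2r; exact: (proj2 sp).
Qed.

Lemma inf_along_le_id v : inf_along p K v <= p v.
Proof.
by have [K0 _ _] := cK; have := inf_along_le v K0; rewrite addr0 subr0.
Qed.

Lemma inf_along_oppr w a : K (w, a) -> inf_along p K (- w) <= - a.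
Proof.
by move=> /(inf_along_le (- w)); rewrite addNr (sublinear0 sp) sub0r.
Qed.

End InfAlong.

Lemma cone_set_ray (v : V) (a : R) :
  cone_set [set wb | exists2 t, 0 <= t & wb = (t *: v, t * a)].
Proof.
split.
- by exists 0 => //; rewrite scale0r mul0r.
- move=> _ _ _ _ [s s0 [-> ->]] [t t0 [-> ->]]; exists (s + t).
    exact: addr_ge0.
  by rewrite scalerDl mulrDl.
- move=> s _ _ s0 [t t0 [-> ->]]; exists (s * t).
    by rewrite mulr_ge0// ltW.
  by rewrite scalerA mulrA.
Qed.

Lemma sublinear_ray p v : sublinear p -> forall w a,
  [set wb | exists2 t, 0 <= t & wb = (t *: v, t * p v)] (w, a) -> a <= p w.
Proof. by move=> sp w a [t t0 [-> ->]]; rewrite sublinearZ. Qed.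

(** Lowering [q] along the ray through [(v, q v)] cannot change it, by minimality, yet forces
    [q (- v) <= - q v]. So [q] is odd, and subadditivity at [- x], [- y] reverses the one at [x],
    [y]. *)
Lemma minimal_sublinear_linear q : sublinear q ->
  (forall r, sublinear r -> (forall x, r x <= q x) -> r = q) ->
  linear (q : V -> R^o).
Proof.
move=> sq qmin.
have qN v : q (- v) = - q v.
  set K := [set wb | exists2 t, 0 <= t & wb = (t *: v, t * q v)].
  have cK : cone_set K by exact: cone_set_ray.
  have qK : forall w a, K (w, a) -> a <= q w by exact: sublinear_ray.
  have eqK := qmin _ (inf_along_sublinear sq cK qK) (inf_along_le_id sq cK qK).
  have Kv : K (v, q v) by exists 1 => //; rewrite scale1r mul1r.
  have := inf_along_oppr sq qK Kv; rewrite eqK.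
  by have := sublinear_geN v sq; lra.
have qD x y : q (x + y) = q x + q y.
  apply/eqP; rewrite eq_le (proj1 sq)/=.
  by have := proj1 sq (- x) (- y); rewrite -opprD !qN; lra.
move=> t x y; rewrite qD; congr (_ + _).
have [t0|t0] := leP 0 t; first exact: sublinearZ.
rewrite -[t]opprK scaleNr qN sublinearZ ?oppr_ge0 ?ltW//.
by rewrite scaleNr [in RHS]/GRing.scale/=.
Qed.

(** Zorn's lemma for the reversed pointwise order. The infimum over a chain is finite because
    [q x >= - q (- x) >= - p (- x)]. *)
Lemma exists_minimal_sublinear p : sublinear p ->
  exists q, [/\ sublinear q, (forall x, q x <= p x) &
    forall r, sublinear r -> (forall x, r x <= q x) -> r = q].
Proof.
move=> sp.
pose T := {q : V -> R | sublinear q /\ forall x, q x <= p x}.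
pose le (q r : T) : bool := `[< forall x, sval r x <= sval q x >].
have [] := @Zorn T le.
- by move=> q; apply/asboolP.
- move=> q r s /asboolP qr /asboolP rs; apply/asboolP => x.
  exact: le_trans (rs x) (qr x).
- move=> [q Pq] [r Pr] /asboolP/= qr /asboolP/= rq; apply: eq_exist.
  by apply/funext => x; apply/eqP; rewrite eq_le qr rq.
- move=> A totA; have [[[q0 Pq0] Aq0]|A0] := pselect (A !=set0); last first.
    have p0 : sublinear p /\ forall x, p x <= p x by [].
    by exists (exist _ p p0) => s As; exfalso; apply: A0; exists s.
  pose E x := [set sval q x | q in A].
  have lbE x : lbound (E x) (- p (- x)).
    move=> _ [[q [sq qp]] Aq <-] /=.
    by apply: le_trans (sublinear_geN x sq); rewrite lerN2.
  have infE (q : T) x : A q -> inf (E x) <= sval q x.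
    by move=> Aq; apply: ge_inf; [exists (- p (- x)); exact: lbE|exists q].
  have E0 x : E x !=set0 by exists (q0 x), (exist _ q0 Pq0).
  have sr : sublinear (fun x => inf (E x)).
    split=> [x y|t x t0].
      rewrite -lerBlDl; apply: lb_le_inf => // _ [q Aq <-].
      rewrite lerBlDl -lerBlDr; apply: lb_le_inf => // _ [r Ar <-].
      rewrite lerBlDr.
      (* The lower of the two members of the chain bounds both summands. *)
      have [qr|rq] := totA _ _ Aq Ar.
        apply: (le_trans (infE r _ Ar)).
        have := proj1 (proj1 (svalP r)) x y.
        by move: qr => /asboolP/(_ y); lra.
      apply: (le_trans (infE q _ Aq)).
      have := proj1 (proj1 (svalP q)) x y.
      by move: rq => /asboolP/(_ x); lra.
    rewrite -ler_pdivrMl//; apply: lb_le_inf => // _ [q Aq <-].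
    rewrite ler_pdivrMl//; apply: (le_trans (infE q _ Aq)).
    exact: (proj2 (proj1 (svalP q))).
  have rp x : inf (E x) <= p x.
    by apply: (le_trans (infE _ _ Aq0)); exact: (proj2 Pq0).
  exists (exist _ (fun x => inf (E x)) (conj sr rp)) => q Aq.
  by apply/asboolP => x; exact: infE.
- move=> [q [sq qp]] qmin; exists q; split=> // r sr rq.
  have rp x : r x <= p x by exact: le_trans (rq x) (qp x).
  have := qmin (exist _ r (conj sr rp)) _.
  by move=> /(_ (asboolT rq))/(congr1 sval).
Qed.

(** A minimal sublinear functional below [inf_along p K] is linear. Suitable choices of [K] give
    extension, support and separation below. *)
Lemma mazur_orlicz p K : sublinear p -> cone_set K ->
  (forall w a, K (w, a) -> a <= p w) ->
  exists f : V -> R^o, [/\ linear f, (forall x, f x <= p x) &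
    forall w a, K (w, a) -> a <= f w].
Proof.
move=> sp cK pK.
have [f [sf fp fmin]] :=
  exists_minimal_sublinear (inf_along_sublinear sp cK pK).
have lf := minimal_sublinear_linear sf fmin.
exists f; split=> // [x|w a Kwa].
  by apply: (le_trans (fp x)); exact: inf_along_le_id.
have fN : f (- w) = - f w.
  by have := lf (-1) w 0; rewrite addr0 (sublinear0 sf) addr0 !scaleN1r.
by have := inf_along_oppr sp pK Kwa; have := fp (- w); rewrite fN; lra.
Qed.

End Sublinear.

(** * The dual norm and support functionals *)

Section DualNorm.
Context {R : realType} {X : normedModType R}.
Implicit Types (f g : dual X) (x y : X).

Lemma normrZ_gt0 (t : R) x : 0 < t -> `|t *: x| = t * `|x|.
Proof. by move=> t0; rewrite normrZ gtr0_norm. Qed.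

Lemma dualB f g x : (f - g) x = (f x : R) - (g x : R).
Proof. by []. Qed.

Lemma dualZ (t : R) f x : (t *: f) x = t * (f x : R).
Proof. by []. Qed.

Lemma dual_addZ f (t : R) x y : f (x + t *: y) = (f x : R) + t * (f y : R).
Proof. by rewrite linearD linearZ. Qed.

Lemma ler_dual f x : `|f x| <= `|f| * `|x|.
Proof.
have unitle z : `|z| <= 1 -> `|f z| <= `|f|.
  move=> z1; apply: sup_upper_bound; last by exists z.
  split; first by exists `|f 0|, 0 => //=; rewrite normr0.
  have : bounded_near f (nbhs (0 : X)).
    by apply: continuous_linear_bounded; exact: dual_continuous.
  move/bounded_funP => /(_ 1)[M fM].
  by exists M => _ [u u1 <-]; exact: fM.
have [->|x0] := eqVneq x 0; first by rewrite linear0 !normr0 mulr0.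
have nx0 : 0 < `|x| by rewrite normr_gt0.
have := unitle (`|x|^-1 *: x).
rewrite linearZ/= !normrZ normfV normr_id mulVf ?gt_eqF// => /(_ (lexx _)).
by rewrite ler_pdivrMl// mulrC.
Qed.

Lemma dual_norm_le f (M : R) :
  0 <= M -> (forall x, f x <= M * `|x|) -> `|f| <= M.
Proof.
move=> M0 fM; apply: ge_sup; first by exists `|f 0|, 0 => //=; rewrite normr0.
move=> _ [x x1 <-]; rewrite ler_norml; apply/andP; split.
  rewrite lerNl -linearN; apply: (le_trans (fM _)).
  by rewrite normrN -[leRHS]mulr1 ler_wpM2l.
by apply: (le_trans (fM _)); rewrite -[leRHS]mulr1 ler_wpM2l.
Qed.

Lemma dual_of_bounded (f : X -> R^o) (M : R) : linear f -> 0 <= M ->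
  (forall x, f x <= M * `|x|) ->
  exists2 g : dual X, g = f :> (X -> R^o) & `|g| <= M.
Proof.
move=> lf M0 fM.
pose fl : {linear X -> R^o} :=
  HB.pack f (GRing.isLinear.Build R X R^o *:%R f lf).
have fc : continuous f.
  apply: (@bounded_linear_continuous _ _ _ fl); apply/bounded_funP => r.
  exists (M * r) => x xr; rewrite ler_norml; apply/andP; split.
    have -> : fl x = - fl (- x) by rewrite linearN opprK.
    by rewrite lerN2; apply: (le_trans (fM _)); rewrite normrN ler_wpM2l.
  by apply: (le_trans (fM _)); rewrite ler_wpM2l.
have fd : f \in @dual_pred R X by rewrite inE.
by exists (Dual fd) => //; exact: dual_norm_le.
Qed.

Lemma sublinear_norm : sublinear (fun x : X => `|x|).
Proof.
split=> [x y|t x t0]; first exact: ler_normD.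
by rewrite normrZ gtr0_norm.
Qed.

Lemma duality_mapP x f : `|x| = 1 ->
  duality_map x f <-> (forall y, f y <= `|y|) /\ f x = 1.
Proof.
move=> x1; split=> [[f1 fx]|[fle fx]].
  split=> // y; apply: (le_trans (ler_norm _)).
  by apply: (le_trans (ler_dual f y)); rewrite f1 mul1r.
split=> //; apply/eqP; rewrite eq_le dual_norm_le//=; last first.
  by move=> y; rewrite mul1r.
by have := ler_dual f x; rewrite fx x1 mulr1 normr1.
Qed.

Lemma dual_eq f g : f =1 g -> f = g.
Proof. by move=> fg; apply: val_inj; exact/funext. Qed.

End DualNorm.

(** * Passage to closed subspaces *)

Section Heredity.
Context {R : realType} {X : normedModType R} (Y : closed_subspace X).
Implicit Types y z : subspace_type Y.

(** The cone is the graph of [g]; as it is symmetric, the constraints at [y] and [- y] together give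
    equality. *)
Lemma dual_extension (g : dual (subspace_type Y)) :
  exists2 f : dual X, (forall y, f (val y) = g y) & `|f| <= `|g|.
Proof.
pose K := [set wa : X * R | exists y : subspace_type Y, wa = (val y, g y)].
have cK : cone_set K.
  split.
  - by exists 0; rewrite !linear0.
  - move=> _ _ _ _ [y [-> ->]] [z [-> ->]]; exists (y + z).
    by rewrite !linearD.
  - by move=> t _ _ t0 [y [-> ->]]; exists (t *: y); rewrite !linearZ.
have sg : sublinear (fun x : X => `|g| * `|x|).
  split=> [x y|t x t0]; first by rewrite -mulrDr ler_wpM2l// ler_normD.
  by rewrite normrZ gtr0_norm// mulrCA.
have [|f [lf fg fK]] := mazur_orlicz sg cK.
  by move=> _ _ [y [-> ->]]; apply: (le_trans (ler_norm _)); exact: ler_dual.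
have [h hf hg] := dual_of_bounded lf (normr_ge0 g) fg.
exists h => // y; apply/eqP; rewrite eq_le.
have le z : g z <= h (val z) by rewrite hf; apply: fK; exists z.
rewrite le andbT; have := le (- y).
by rewrite !linearN/= lerN2.
Qed.

Lemma dual_restriction (f : dual X) :
  exists2 g : dual (subspace_type Y),
    (forall y, g y = f (val y)) & `|g| <= `|f|.
Proof.
pose g0 (y : subspace_type Y) : R^o := f (val y).
have lg : linear g0.
  by move=> t y z; rewrite /g0 -(linearP f) -linearP.
have [y|g gE gf] := dual_of_bounded lg (normr_ge0 f).
  by apply: (le_trans (ler_norm _)); exact: ler_dual.
by exists g => // y; rewrite gE.
Qed.

Lemma duality_map_extension y (g : dual (subspace_type Y)) : `|y| = 1 ->
  duality_map y g ->
  exists2 f : dual X, duality_map (val y) f & forall z, f (val z) = g z.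
Proof.
move=> y1 [g1 gy]; have [f fE fg] := dual_extension g; exists f => //.
apply/duality_mapP; first exact: y1.
split=> [x|]; last by rewrite fE.
apply: (le_trans (ler_norm _)); apply: (le_trans (ler_dual f x)).
by rewrite -[leRHS]mul1r ler_wpM2r//; move: fg; rewrite g1.
Qed.

Lemma duality_map_restriction y (f : dual X) : `|y| = 1 ->
  duality_map (val y) f ->
  exists2 g : dual (subspace_type Y),
    duality_map y g & forall z, g z = f (val z).
Proof.
move=> y1 [f1 fy]; have [g gE gf] := dual_restriction f; exists g => //.
apply/duality_mapP => //; split=> [z|]; last by rewrite gE.
apply: (le_trans (ler_norm _)); apply: (le_trans (ler_dual g z)).
by rewrite -[leRHS]mul1r ler_wpM2r//; move: gf; rewrite f1.
Qed.

(** Every support functional at [y] extends to one at [val y], which must be [f]; hence it is the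
    restriction of [f]. *)
Lemma smooth_point_subspace y : `|y| = 1 ->
  smooth_point (val y) -> smooth_point y.
Proof.
move=> y1 [f Df].
have [|g Dg gE] := @duality_map_restriction y f y1; first by rewrite Df.
exists g; apply/seteqP; split=> [h Dh|_ ->//].
have [k Dk kE] := duality_map_extension y1 Dh; move: Dk; rewrite Df /= => kf.
by apply: dual_eq => z; rewrite -kE gE kf.
Qed.

(** A support functional at a nearby [z] extends to one at [val z], close to [f], and restriction
    does not increase norms. *)
Lemma frechet_smooth_point_subspace y : `|y| = 1 ->
  frechet_smooth_point (val y) -> frechet_smooth_point y.
Proof.
move=> y1 [f [Df cf]].
have [|g Dg gE] := @duality_map_restriction y f y1; first by rewrite Df.
have [g' Dg'] : smooth_point y by apply: smooth_point_subspace => //; exists f.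
have gg' : g = g' by move: Dg; rewrite Dg'.
subst g'; exists g; split=> // e e0.
have /nbhs_ballP[d /= d0 dcf] := cf e e0.
apply/nbhs_ballP; exists d => //= z; rewrite -ball_normE => yz z1 h Dh.
have [k Dk kE] := duality_map_extension z1 Dh.
have kfe : `|k - f| < e.
  by apply: (dcf (val z)); [rewrite -ball_normE; exact: yz|exact: z1|exact: Dk].
apply: le_lt_trans kfe; apply: dual_norm_le => // u.
rewrite dualB -kE gE -dualB; apply: (le_trans (ler_norm _)).
exact: (ler_dual (k - f) (val u)).
Qed.

Lemma smooth_subspace : smooth X -> smooth (subspace_type Y).
Proof. by move=> sX y y1; apply: smooth_point_subspace => //; exact: sX. Qed.

Lemma finite_nonfrechet_points_subspace :
  finite_set (nonfrechet_points X) ->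
  finite_set (nonfrechet_points (subspace_type Y)).
Proof.
move=> fin; apply: sub_finite_set (finite_preimage (f := val) _ fin).
  move=> y [y1 nfy]; split=> // fy; apply: nfy.
  exact: frechet_smooth_point_subspace.
by move=> y z _ _; exact: val_inj.
Qed.

End Heredity.

(** * One-sided derivative of a smooth norm, and Ekeland's principle *)

Section BishopPhelps.
Context {R : realType}.

(** If the bound failed for every [s > 0], Mazur-Orlicz would yield a support functional at [x] with
    value at least [a] at [v], hence different from [g]. One good [s0] suffices by convexity of the
    norm. *)
Lemma smooth_norm_derivative {X : normedModType R}
    (x v : X) (g : dual X) (a : R) :
  `|x| = 1 -> duality_map x = [set g] -> g v < a ->
  exists2 s0, 0 < s0 & forall s, 0 < s <= s0 -> `|x + s *: v| <= 1 + s * a.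
Proof.
move=> x1 Dx gva.
have [s0 s00 s0a] : exists2 s0, 0 < s0 & `|x + s0 *: v| <= 1 + s0 * a.
  apply: contrapT => H.
  have xva s : 0 <= s -> 1 + s * a <= `|x + s *: v|.
    rewrite le_eqVlt => /predU1P[<-|s0].
      by rewrite mul0r scale0r !addr0 x1.
    by rewrite leNgt; apply/negP => /ltW xsv; apply: H; exists s.
  pose K := [set wb : X * R | exists t s, 0 <= s /\
     wb = (t *: x + s *: v, t + s * a)].
  have cK : cone_set K.
    split.
    - by exists 0, 0; rewrite !scale0r mul0r !addr0.
    - move=> _ _ _ _ [t [s [s0 [-> ->]]]] [t' [s' [s'0 [-> ->]]]].
      exists (t + t'), (s + s'); split; first exact: addr_ge0.
      by rewrite !scalerDl mulrDl (addrACA t) (addrACA (t *: x)).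
    - move=> r _ _ r0 [t [s [s0 [-> ->]]]].
      exists (r * t), (r * s); split; first by rewrite mulr_ge0// ltW.
      by rewrite scalerDr !scalerA mulrDr mulrA.
  have [|f [lf fle fK]] := mazur_orlicz (@sublinear_norm R X) cK.
    move=> _ _ [t [s [s0 [-> ->]]]].
    (* Since [t] may be negative, the vector is compared with [r *: x + s *: v] for a positive
       [r >= t]; the two differ by [(r - t) *: x], of norm [r - t]. *)
    pose r := `|t| + 1.
    have r0 : 0 < r by rewrite ltr_wpDl.
    have tr : t <= r by rewrite /r; have := ler_norm t; lra.
    have := xva (s / r) ltac:(by rewrite divr_ge0// ltW).
    have rE : r * `|x + (s / r) *: v| = `|r *: x + s *: v|.
      rewrite -[X in X * _](gtr0_norm r0) -normrZ scalerDr scalerA.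
      by rewrite mulrCA mulfV ?gt_eqF// mulr1.
    rewrite -(ler_pM2l r0) rE mulrDr mulr1 mulrA (mulrCA r).
    rewrite mulfV ?gt_eqF// mulr1.
    have -> : r *: x + s *: v = (t *: x + s *: v) + (r - t) *: x.
      by rewrite addrAC -scalerDl addrCA subrr addr0.
    have := ler_normD (t *: x + s *: v) ((r - t) *: x).
    by rewrite normrZ x1 mulr1 ger0_norm ?subr_ge0//; lra.
  have [|h hf _] := dual_of_bounded lf ler01; first by move=> y; rewrite mul1r.
  have hg : duality_map x h.
    apply/duality_mapP => //; split=> [y|]; first by rewrite hf.
    apply/eqP; rewrite hf eq_le -{1}x1 fle fK//; exists 1, 0.
    by rewrite scale0r scale1r mul0r !addr0.
  have : a <= f v.
    by apply: fK; exists 0, 1; rewrite !scale0r scale1r mul1r !add0r.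
  by move: hg; rewrite Dx /= => hg; rewrite -hf hg leNgt gva.
exists s0 => // s /andP[s_gt0 ss0].
(* A convex combination of [x] and [x + s0 *: v]. *)
have -> : x + s *: v = (1 - s / s0) *: x + (s / s0) *: (x + s0 *: v).
  by rewrite scalerDr scalerA divfK ?gt_eqF// addrA -scalerDl subrK scale1r.
apply: (le_trans (ler_normD _ _)); rewrite 2!normrZ x1 mulr1.
have ss01 : s / s0 <= 1 by rewrite ler_pdivrMr ?mul1r.
have ss0p : 0 < s / s0 by rewrite divr_gt0.
rewrite ger0_norm ?subr_ge0// gtr0_norm//.
have := s0a; rewrite -(ler_pM2l ss0p) mulrDr mulr1 mulrA divfK ?gt_eqF//. lra.
Qed.

(** Each [u n.+1] minimises [h] over the set [S (u n)] up to [1/(n+1)], so the nested closed sets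
    [S (u n)] have diameters tending to 0 and [u] converges to their common point. *)
Lemma ekeland {X : completeNormedModType R} (h : X -> R) (m e : R) :
  continuous h -> (forall x, m <= h x) -> 0 < e ->
  exists x0, forall x, h x0 <= h x + e * `|x - x0|.
Proof.
move=> ch mh e0.
pose S x y := h y + e * `|y - x| <= h x.
have Sxx x : S x x by rewrite /S subrr normr0 mulr0 addr0.
have Strans x y z : S x y -> S y z -> S x z.
  rewrite /S => xy yz.
  have : e * `|z - x| <= e * `|z - y| + e * `|y - x|.
    rewrite -mulrDr ler_pM2l//.
    by rewrite (le_trans _ (ler_normD _ _))// addrA subrK.
  lra.
have /choice[next nextP] (nx : nat * X) : exists y,
    S nx.2 y /\ forall z, S nx.2 z -> h y <= h z + nx.1.+1%:R^-1.
  case: nx => n x /=.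
  have infS : has_inf [set h z | z in S x].
    by split; [exists (h x), x|exists m => _ [z _ <-]].
  have n0 : 0 < n.+1%:R^-1 :> R by rewrite invr_gt0.
  have [_ [y Sy <-] hy] := inf_adherent n0 infS.
  exists y; split=> // z Sz; apply: (le_trans (ltW hy)); rewrite lerD2r.
  by apply: ge_inf; [exact: (proj2 infS)|exists z].
pose u := fix u n : X := if n is k.+1 then next (k, u k) else 0.
have uS n k : S (u n) (u (n + k)%N).
  elim: k => [|k IH]; first by rewrite addn0.
  by rewrite addnS; apply: Strans IH _; exact: (proj1 (nextP (_, _))).
have Sdist n z : S (u n.+1) z -> `|z - u n.+1| <= e^-1 * n.+1%:R^-1.
  move=> Sz; have Snz : S (u n) z by apply: Strans Sz; rewrite -addn1.
  have hz : h (u n.+1) <= h z + n.+1%:R^-1 := proj2 (nextP (n, u n)) z Snz.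
  by rewrite ler_pdivlMl// -(lerD2l (h z)); exact: le_trans Sz hz.
have small (d : R) : 0 < d -> exists n, e^-1 * n.+1%:R^-1 < d.
  move=> d0; have ed0 : 0 < e * d by rewrite mulr_gt0.
  have [n _ /(_ n (leqnn n))/= nd] := near_infty_natSinv_lt (PosNum ed0).
  by exists n; rewrite ltr_pdivrMl.
have ul : cvg (u @ \oo).
  apply: cauchy_cvg; apply: cauchy_exP => d d0.
  have [n nd] := small d d0; exists (u n.+1); exists n.+1 => // k /= nk.
  rewrite -ball_normE/= distrC; apply: le_lt_trans nd; apply: Sdist.
  by rewrite -(subnKC nk).
pose l := lim (u @ \oo).
have Sl n : S (u n) l.
  apply: (@closed_cvg _ _ (u @ \oo) _ id [set y | S (u n) y]); last exact: ul.
    have cS : continuous (fun y => h y + e * `|y - u n|).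
      move=> y; apply: cvgD; first exact: ch.
      apply: cvgMl_tmp; apply: cvg_norm.
      by apply: cvgB; [exact: cvg_id|exact: cvg_cst].
    exact: (preimage_closed (fun y _ => cS y) (@closed_le _ (h (u n)))).
  by exists n => // k /= nk; rewrite -(subnKC nk).
exists l => z; rewrite leNgt; apply/negP => zl.
(* A violating [z] lies in every [S (u n)], as [l] does, so the two coincide. *)
have Slz : S l z by exact: ltW.
have zE : z = l.
  apply/eqP; rewrite -subr_eq0 -normr_le0 leNgt; apply/negP => zl0.
  have [n] := small (`|z - l| / 2) ltac:(by rewrite divr_gt0).
  have := Sdist n _ (Strans _ _ _ (Sl n.+1) Slz).
  have := Sdist n _ (Sl n.+1).
  have := ler_normD (z - u n.+1) (u n.+1 - l).
  rewrite addrA subrK (distrC (u n.+1)).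
  by move: (e^-1 * _) => d; lra.
by move: zl; rewrite zE subrr normr0 mulr0 addr0 ltxx.
Qed.

End BishopPhelps.

(** * Bishop-Phelps density for a smooth norm *)

Section Density.
Context {R : realType}.

(** The limit as [t] decreases to 0; it removes second-order terms after division by [t]. *)
Lemma ler_addMsmall (t0 k a b : R) : 0 < t0 ->
  (forall t, 0 < t <= t0 -> a <= b + t * k) -> a <= b.
Proof.
move=> t00 H; apply/ler_addgt0Pr => e e0.
have k0 : 0 < `|k| + 1 by rewrite ltr_wpDl.
pose t := Num.min t0 (e / (`|k| + 1)).
have t_gt0 : 0 < t by rewrite lt_min t00 divr_gt0.
apply: (le_trans (H t _)); first by rewrite t_gt0 ge_min lexx.
rewrite lerD2l; apply: (@le_trans _ _ (t * (`|k| + 1))).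
  by rewrite ler_pM2l//; have := ler_norm k; lra.
by rewrite -ler_pdivlMr// ge_min lexx orbT.
Qed.

Lemma half_sqr_norm_sub_lb {X : normedModType R} (f : dual X) x :
  - (`|f| ^+ 2 / 2) <= `|x| ^+ 2 / 2 - (f x : R).
Proof.
have := ler_dual f x; have := ler_norm (f x).
have := sqr_ge0 (`|x| - `|f|); rewrite sqrrB mulr2n; lra.
Qed.

(* The derivative of [|x|^2/2] at [x0] is [|x0|] times the functional dual to
   [x0/|x0|]. *)
Lemma almost_critical_point {X : normedModType R}
    (f : dual X) (e : R) (x0 : X) :
  smooth X -> 0 < e ->
  (forall x, `|x0| ^+ 2 / 2 - (f x0 : R) <=
             `|x| ^+ 2 / 2 - (f x : R) + e * `|x - x0|) ->
  e < `|f| ->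
  exists x (g : dual X) c,
    [/\ `|x| = 1, duality_map x = [set g], 0 < c & `|c *: g - f| <= e].
Proof.
move=> sX e0 hx0.
have H (v : X) t : 0 < t ->
    `|x0| ^+ 2 / 2 + t * (f v : R) <= `|x0 + t *: v| ^+ 2 / 2 + t * (e * `|v|).
  move=> t0; have := hx0 (x0 + t *: v).
  have -> : x0 + t *: v - x0 = t *: v by rewrite addrAC subrr add0r.
  rewrite (dual_addZ f) normrZ_gt0// (mulrCA e); lra.
have [x00|x00] := eqVneq x0 0.
  (* At [x0 = 0] the derivative of the squared norm vanishes, so [f] itself would have norm at most
     [e]. *)
  have fe : `|f| <= e.
    apply: dual_norm_le => [|v]; first exact: ltW.
    apply: (@ler_addMsmall 1 (`|v| ^+ 2 / 2)) => // t /andP[t0 _].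
    rewrite -(ler_pM2l t0); have := H v t t0.
    rewrite x00 normr0 add0r normrZ_gt0// exprMn !expr2; lra.
  by rewrite ltNge fe.
move=> _; have a0 : 0 < `|x0| by rewrite normr_gt0.
pose u := `|x0|^-1 *: x0.
have u1 : `|u| = 1 by rewrite normrZ normfV normr_id mulVf ?gt_eqF.
have [g Dg] := sX u u1.
have key v : f v <= `|x0| * g v + e * `|v|.
  (* The slack [d] makes [K] strictly larger than [g v], as the derivative bound requires. *)
  apply/ler_addgt0Pr => d d0.
  pose K := g v + d / `|x0|.
  have gK : g v < K by rewrite ltrDl divr_gt0.
  have [s0 s00 s0K] := smooth_norm_derivative u1 Dg gK.
  have -> : `|x0| * g v + e * `|v| + d = `|x0| * K + e * `|v|.
    by rewrite /K mulrDr mulrCA mulfV ?gt_eqF// mulr1; lra.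
  apply: (@ler_addMsmall (`|x0| * s0) (K ^+ 2 / 2)); first exact: mulr_gt0.
  move=> t /andP[t0 ts0].
  have tK : `|x0 + t *: v| <= `|x0| + t * K.
    have -> : x0 + t *: v = `|x0| *: (u + (t / `|x0|) *: v).
      rewrite scalerDr !scalerA mulfV ?gt_eqF// scale1r mulrCA mulfV ?gt_eqF//.
      by rewrite mulr1.
    rewrite normrZ normr_id; have := s0K (t / `|x0|).
    rewrite divr_gt0//= ler_pdivrMr// (mulrC s0) => /(_ ts0).
    rewrite -(ler_pM2l a0) mulrDr mulr1 mulrA.
    by rewrite (mulrC `|x0| (t / _)) divfK ?gt_eqF.
  have tK2 : `|x0 + t *: v| ^+ 2 <= (`|x0| + t * K) ^+ 2.
    by rewrite ler_pXn2r// nnegrE// (le_trans _ tK).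
  rewrite -(ler_pM2l t0); have := H v t t0; move: tK2.
  rewrite sqrrD mulr2n exprMn !expr2; lra.
exists u, g, `|x0|; split=> //.
apply: dual_norm_le => [|v]; first exact: ltW.
rewrite dualB dualZ; have := key (- v); rewrite normrN !linearN /= mulrN; lra.
Qed.


Lemma bishop_phelps {X : completeNormedModType R} (f : dual X) (e : R) :
  smooth X -> f != 0 -> 0 < e ->
  exists x (g : dual X) c,
    [/\ `|x| = 1, duality_map x = [set g], 0 < c & `|c *: g - f| <= e].
Proof.
move=> sX f0 e_gt0.
have nf0 : 0 < `|f| by rewrite normr_gt0.
(* Being below [|f|], the tolerance [e'] excludes 0 as the almost critical point. *)
pose e' := Num.min e (`|f| / 2).
have e'0 : 0 < e' by rewrite lt_min e_gt0 divr_gt0.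
have e'f : e' < `|f|.
  by apply: (@le_lt_trans _ _ (`|f| / 2)); [rewrite ge_min lexx orbT|lra].
pose h (x : X) : R := `|x| ^+ 2 / 2 - (f x : R).
have ch : continuous h.
  move=> x; apply: cvgB; last exact: dual_continuous.
  apply: cvgMr_tmp.
  apply: (@cvg_comp _ _ _ (fun y : X => `|y|) (fun t : R => t ^+ 2) _
    (nbhs `|x|)).
    exact: norm_continuous.
  exact: exprn_continuous.
have hm x : - (`|f| ^+ 2 / 2) <= h x by exact: half_sqr_norm_sub_lb.
have [x0 hx0] := ekeland ch hm e'0.
have [x [g [c [x1 Dx c0 cg]]]] := almost_critical_point sX e'0 hx0 e'f.
by exists x, g, c; split=> //; apply: (le_trans cg); rewrite ge_min lexx.
Qed.

End Density.

(** * Approximation by functionals supported at Frechet smooth points *)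

Section FrechetDensity.
Context {R : realType}.

(** The only unit functionals are [h] and [- h]. If [g y = 1] and [|x - y| < 1], then [g x > 0], so
    [g = h]. *)
Lemma frechet_of_dual_line {X : normedModType R} (f : dual X) (x : X) :
  (forall g : dual X, exists a, g = a *: f) -> `|x| = 1 ->
  smooth_point x -> frechet_smooth_point x.
Proof.
move=> lf x1 [h Dh]; exists h; split=> // e e0.
have [h1 hx] : duality_map x h by rewrite Dh.
apply/nbhs_ballP; exists 1 => //= y; rewrite -ball_normE /= => xy y1 g [g1 gy].
have [a ga] := lf g; have [b hb] := lf h.
have b0 : b != 0.
  apply/eqP => b0; move: h1; rewrite hb b0 scale0r /unit_sphere /= normr0.
  by move/eqP; rewrite eq_sym oner_eq0.
have gh : g = (a / b) *: h by rewrite hb scalerA divfK.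
have ab1 : `|a / b| = 1.
  by move: g1; rewrite gh /unit_sphere /= normrZ (h1 : `|h| = 1) mulr1.
have gx : 0 < (g x : R).
  have -> : g x = (g y : R) + g (x - y) by rewrite -linearD addrC subrK.
  rewrite gy; have := ler_dual g (x - y); rewrite (g1 : `|g| = 1) mul1r.
  by have := ler_norm (- g (x - y)); rewrite normrN; lra.
have ab : a / b = 1.
  by rewrite -ab1 gtr0_norm//; move: gx; rewrite gh dualZ hx mulr1.
by rewrite gh ab scale1r subrr normr0.
Qed.

Lemma finite_set_uniform (T : eqType) (A : set T) (Q : T -> R -> Prop) :
  finite_set A -> (forall x d d', d' <= d -> Q x d -> Q x d') ->
  (forall x, A x -> exists2 d, 0 < d & Q x d) ->
  exists2 d, 0 < d & forall x, A x -> Q x d.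
Proof.
move=> /finite_seqP[s ->] Qmono; elim: s => [|x s IH] H.
  by exists 1 => // x; rewrite /= in_nil.
have [|d d0 Hd] := IH; first by move=> y sy; apply: H; rewrite /= inE sy orbT.
have [|d' d'0 Hd'] := H x; first by rewrite /= inE eqxx.
exists (Num.min d d'); first by rewrite lt_min d0.
move=> y; rewrite /= inE => /predU1P[->|sy].
  by apply: Qmono Hd'; rewrite ge_min lexx orbT.
by apply: Qmono (Hd y sy); rewrite ge_min lexx.
Qed.

(** Evaluation at [x] gives [|f x - c| <= |c *: g - f|]. Thus the coefficient [f x] is optimal up to
    a factor 2. *)
Lemma line_distance {X : normedModType R} (f g : dual X) (c : R) x :
  `|x| = 1 -> `|g| = 1 -> g x = 1 ->
  `|(f x : R) *: g - f| <= 2 * `|c *: g - f|.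
Proof.
move=> x1 g1 gx.
have -> : (f x : R) *: g - f = ((f x : R) - c) *: g + (c *: g - f).
  by rewrite scalerBl addrA subrK.
apply: (le_trans (ler_normD _ _)); rewrite mulrDl mul1r lerD2r.
rewrite normrZ g1 mulr1 distrC; have := ler_dual (c *: g - f) x.
by rewrite dualB dualZ gx mulr1 x1 mulr1.
Qed.

Section Complete.
Variable X : completeNormedModType R.
Hypotheses (sX : smooth X) (finN : finite_set (nonfrechet_points X)).
Implicit Types (f g : dual X) (x : X).

Let approx f e := exists x g c,
  [/\ `|x| = 1, frechet_smooth_point x, duality_map x = [set g], 0 < c &
      `|c *: g - f| <= e].

(** Membership of [f] in the line spanned by [D(x)]: since [g x = 1], the coefficient can only be
    [f x]. *)
Let on_line f x := exists2 g, duality_map x = [set g] & (f x : R) *: g = f.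

Let approx_off_lines f e : f != 0 -> 0 < e ->
  (forall x, nonfrechet_points X x -> ~ on_line f x) -> approx f e.
Proof.
move=> f0 e0 off.
have [||d d0 Hd] := @finite_set_uniform _ _
    (fun x d => forall g (c : R), duality_map x = [set g] ->
      d < `|c *: g - f|) finN.
- by move=> x d d' dd' + g c Dg => /(_ g c Dg); exact: le_lt_trans.
- move=> x Nx; have [x1 _] := Nx; have [g Dg] := sX x1.
  have [g1 gx] : duality_map x g by rewrite Dg.
  have gf0 : 0 < `|(f x : R) *: g - f|.
    by rewrite normr_gt0 subr_eq0; apply/eqP => gf; apply: (off x Nx); exists g.
  (* The divisor 3 exceeds the factor 2 of [line_distance], which makes the bound strict. *)
  exists (`|(f x : R) *: g - f| / 3); first by rewrite divr_gt0.
  move=> g' c; rewrite Dg => /seteqP[_ /(_ g' erefl)] /= ->.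
  rewrite ltNge; apply/negP => cgf.
  have := le_trans (line_distance f c x1 g1 gx) (ler_wpM2l (ler0n R 2) cgf).
  by rewrite mulrCA leNgt gtr_pMr// ltr_pdivrMr// mul1r ltr_nat.
have de0 : 0 < Num.min d e by rewrite lt_min d0.
have [x [g [c [x1 Dx c0 cg]]]] := bishop_phelps sX f0 de0.
exists x, g, c; split=> //; last first.
  by apply: (le_trans cg); rewrite ge_min lexx orbT.
apply: contrapT => nfx.
have := Hd x (conj x1 nfx) g c Dx; rewrite ltNge => /negP; apply.
by apply: (le_trans cg); rewrite ge_min lexx.
Qed.

(** For [s != t], solving the two equations makes both [f] and [g0] multiples of [g]; as [f] is
    nonzero, [g0] is then a multiple of [f]. *)
Let on_line_inj f g0 x (s t : R) : f != 0 -> (forall a, g0 != a *: f) ->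
  on_line (f + s *: g0) x -> on_line (f + t *: g0) x -> s = t.
Proof.
move=> f0 g0f [g Dg gs] [g' Dg' gt].
have gg : g' = g by move: Dg'; rewrite Dg => /seteqP[_ /(_ g' erefl)].
move: gs gt; rewrite gg.
set a := (X in X *: g); set b := (X in _ -> X *: g = _ -> _).
move=> gs gt; apply/eqP; apply: contraT => st.
have ts0 : t - s != 0 by rewrite subr_eq0 eq_sym.
have fE : (t - s) *: f = (t * a - s * b) *: g.
  rewrite !scalerBl -!scalerA gs gt !scalerDr !scalerA (mulrC s t).
  by rewrite opprD addrACA subrr addr0.
have gE : (t - s) *: g0 = (b - a) *: g.
  by rewrite !scalerBl gs gt opprD addrACA subrr add0r.
have d0 : t * a - s * b != 0.
  apply: contraNneq f0 => d0; move: fE; rewrite d0 scale0r => /eqP.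
  by rewrite scaler_eq0 (negPf ts0).
have := g0f ((t - s)^-1 * (b - a) * (t * a - s * b)^-1 * (t - s)).
rewrite -scalerA fE scalerA divfK// -scalerA -gE scalerA mulVf// scale1r.
by rewrite eqxx.
Qed.

Lemma frechet_duality_dense f e : f != 0 -> 0 < e -> exists x g c,
  [/\ `|x| = 1, frechet_smooth_point x, duality_map x = [set g], 0 < c &
      `|c *: g - f| <= e].
Proof.
move=> f0 e0; have [lf|] := pselect (forall g, exists a, g = a *: f).
  have [x [g [c [x1 Dx c0 cg]]]] := bishop_phelps sX f0 e0.
  by exists x, g, c; split=> //; apply: frechet_of_dual_line lf x1 (sX x1).
move=> /existsNP[g0 /forallNP g0f'].
have g0f a : g0 != a *: f by apply/eqP.
have k0 : 0 < 2 * (`|g0| + 1) by rewrite mulr_gt0// ltr_wpDl.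
(* Infinitely many distinct perturbations, each of norm at most [e / 2]. *)
pose t (n : nat) : R := e / (2 * (`|g0| + 1)) / n.+1%:R.
have t0 n : 0 < t n by rewrite !divr_gt0.
have tinj : injective t.
  move=> m n; have c0 : e / (2 * (`|g0| + 1)) != 0 by rewrite gt_eqF ?divr_gt0.
  by move/(mulfI c0)/invr_inj/eqP; rewrite eqr_nat eqSS => /eqP.
have [n offn] : exists n, forall x, nonfrechet_points X x ->
    ~ on_line (f + t n *: g0) x.
  apply: contrapT => /forallNP H.
  have /choice[u uP] n : exists x, nonfrechet_points X x /\
      on_line (f + t n *: g0) x.
    have /existsNP[x /not_implyP[Nx /contrapT lx]] := H n.
    by exists x.
  (* Otherwise [u] would inject the naturals into the finite set of non-Frechet points. *)
  apply: infinite_nat.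
  apply: sub_finite_set (finite_preimage (f := u) _ finN).
    by move=> n _; exact: (proj1 (uP n)).
  move=> m n _ _ umn; apply: tinj.
  apply: (on_line_inj f0 g0f (proj2 (uP m))); rewrite umn.
  exact: (proj2 (uP n)).
have ft0 : f + t n *: g0 != 0.
  apply/negP; rewrite addr_eq0 => /eqP fg.
  have /negP := g0f (- (t n)^-1); apply; apply/eqP.
  by rewrite {1}fg scalerN scaleNr opprK scalerA mulVf ?scale1r// gt_eqF.
have e20 : 0 < e / 2 by rewrite divr_gt0.
have [x [g [c [x1 fx Dx c0 cg]]]] := approx_off_lines ft0 e20 offn.
exists x, g, c; split=> //.
have -> : c *: g - f = c *: g - (f + t n *: g0) + t n *: g0.
  by rewrite opprD addrA subrK.
apply: (le_trans (ler_normD _ _)).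
rewrite [leRHS](splitr e) lerD// normrZ gtr0_norm// /t.
rewrite mulrAC ler_pdivrMr// (@le_trans _ _ (e / 2))//.
  rewrite -mulrA ler_pM2l// invfM -mulrA ler_piMr//.
  by rewrite ler_pdivrMl ?mulr1 ?ltr_wpDl// lerDl.
by rewrite ler_peMr ?ler1n// ltW.
Qed.

End Complete.
End FrechetDensity.

(** * Large balls at Frechet smooth points, and convex separation *)

Section FrechetBalls.
Context {R : realType} {X : normedModType R}.
Implicit Types (f g h : dual X) (x y z : X).

Lemma frechet_smooth_delta x g (e : R) : frechet_smooth_point x ->
  duality_map x = [set g] -> 0 < e ->
  exists2 d, 0 < d & forall z h, `|z| = 1 -> `|x - z| < d -> duality_map z h ->
    `|h - g| < e.
Proof.
move=> [g' [Dg' cg]] Dg e0.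
have <- : g' = g by move: Dg'; rewrite Dg => /seteqP[_ /(_ g' erefl)].
have /nbhs_ballP[d /= d0 dcg] := cg e e0; exists d => // z h z1 xz Dh.
by apply: (dcg z) => //; rewrite -ball_normE.
Qed.

(* Frechet differentiability: if [h] is dual to the direction of [x - w], then
   [|x - w| = h (x - w) <= 1 - g w + |h - g| |w|]. *)
Lemma frechet_norm_expansion x g (e : R) : smooth X -> `|x| = 1 ->
  frechet_smooth_point x -> duality_map x = [set g] -> 0 < e ->
  exists2 d, 0 < d & forall w, `|w| < d -> `|x - w| <= 1 - (g w : R) + e * `|w|.
Proof.
move=> sX x1 fx Dg e0; have [d d0 Hd] := frechet_smooth_delta fx Dg e0.
(* The bound [1/2] keeps [x - w] away from 0; [d / 2] is used because normalising moves [x - w] by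
   at most another [|w|]. *)
exists (Num.min (d / 2) 2^-1).
  by rewrite lt_min divr_gt0//= invr_gt0 ltr0n.
move=> w; rewrite lt_min => /andP[wd w1].
have n1 : `|(`|x - w| - 1)| <= `|w|.
  have := ler_dist_dist (x - w) x.
  by rewrite x1 addrAC subrr add0r normrN.
have xw0 : 0 < `|x - w| by move: n1; rewrite ler_norml => /andP[+ _]; lra.
pose z := `|x - w|^-1 *: (x - w).
have z1 : `|z| = 1 by rewrite normrZ normfV normr_id mulVf ?gt_eqF.
have zE : x - w = `|x - w| *: z by rewrite scalerA mulfV ?gt_eqF// scale1r.
have xz : `|x - z| < d.
  have -> : x - z = w + (`|x - w| - 1) *: z.
    by rewrite scalerBl scale1r -zE addrA addrCA subrr addr0.
  apply: (le_lt_trans (ler_normD _ _)); rewrite normrZ z1 mulr1.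
  by move: n1 wd; lra.
have [h Dh] := sX z z1.
have Dzh : duality_map z h by rewrite Dh.
have hg := Hd z h z1 xz Dzh.
have [h1 hz] := Dzh.
have -> : `|x - w| = (h x : R) - (h w : R).
  transitivity (h (x - w)); last by rewrite linearB.
  by rewrite [in RHS]zE linearZ/= hz [RHS]mulr1.
have hx := ler_dual h x; rewrite x1 (h1 : `|h| = 1) mul1r in hx.
have hw := ler_dual (h - g) w; rewrite dualB in hw.
have hgw : `|h - g| * `|w| <= e * `|w| by rewrite ler_wpM2r// ltW.
have := le_trans hw hgw; rewrite ler_norml => /andP[].
by have := ler_norm (h x : R); move: hx; lra.
Qed.

(** Division by a large [n] brings [y] into the range of the norm expansion with error rate [e / M];
    scaling back leaves an error of at most [e]. *)
Lemma frechet_large_ball x g (M e : R) : smooth X -> `|x| = 1 ->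
  frechet_smooth_point x -> duality_map x = [set g] -> 0 < M -> 0 < e ->
  exists2 n : R, 0 < n &
    forall y, `|y| <= M -> `|n *: x - y| <= n - (g y : R) + e.
Proof.
move=> sX x1 fx Dg M0 e0.
have [d d0 Hd] := frechet_norm_expansion sX x1 fx Dg (divr_gt0 e0 M0).
pose n := 2 * M / d.
have n0 : 0 < n by rewrite !divr_gt0// mulr_gt0.
exists n => // y yM.
have ynd : `|n^-1 *: y| < d.
  rewrite normrZ_gt0 ?invr_gt0// ltr_pdivrMl// /n divfK ?gt_eqF//.
  by apply: le_lt_trans yM _; lra.
have -> : n *: x - y = n *: (x - n^-1 *: y).
  by rewrite scalerBr scalerA mulfV ?gt_eqF// scale1r.
rewrite normrZ_gt0//; have := Hd _ ynd.
have gE : (g (n^-1 *: y) : R) = n^-1 * g y by rewrite linearZ.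
rewrite normrZ_gt0 ?invr_gt0// gE.
rewrite -(ler_pM2l n0) => /le_trans; apply.
rewrite mulrDr mulrBr mulr1 (mulrA n n^-1) mulfV ?gt_eqF// mul1r lerD2l.
rewrite mulrCA (mulrA n n^-1) mulfV ?gt_eqF// mul1r.
by rewrite mulrAC ler_pdivrMr// ler_pM2l.
Qed.

(* Positive linear separation of a point from a closed convex set, as a
   sandwich between the norm and the cone over [C - z] at height [r]. *)
Lemma closed_convex_separation (C : set X) z : closed C -> convex_set C ->
  C !=set0 -> ~ C z ->
  exists (f : dual X) (r : R), 0 < r /\ forall c, C c -> r <= f (c - z).
Proof.
move=> cC vC [c0 Cc0] nCz.
have /nbhs_ballP[r /= r0 rC] : nbhs z (~` C).
  by apply: open_nbhs_nbhs; split=> //; exact: closed_openC.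
have Cr c : C c -> r <= `|c - z|.
  move=> Cc; rewrite leNgt; apply/negP => cz; apply: (rC c) => //.
  by rewrite -ball_normE /= distrC.
pose K := [set wa : X * R | exists s c, [/\ 0 <= s, C c &
  wa = (s *: (c - z), s * r)]].
have cK : cone_set K.
  split.
  - by exists 0, c0; rewrite scale0r mul0r.
  - move=> _ _ _ _ [s [c [s0 Cc [-> ->]]]] [t [d [t0 Cd [-> ->]]]].
    have [st|st] := eqVneq (s + t) 0.
      have [s00 t00] : s = 0 /\ t = 0 by split; lra.
      by exists 0, c; rewrite s00 t00 !scale0r !mul0r !addr0.
    have st0 : 0 < s + t by rewrite lt0r st addr_ge0.
    have l0 : 0 <= s / (s + t) by rewrite divr_ge0// ltW.
    have l1 : s / (s + t) <= 1 by rewrite ler_pdivrMr// mul1r lerDl.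
    have := vC c d (Itv01 l0 l1) (mem_set Cc) (mem_set Cd); rewrite inE.
    have -> : conv (Itv01 l0 l1) (c : convex_lmodType X) d =
      (s / (s + t)) *: c + (1 - s / (s + t)) *: d by [].
    move=> Ce; exists (s + t); eexists; split; [exact: ltW|exact: Ce|].
    rewrite mulrDl; congr pair.
    have -> : 1 - s / (s + t) = t / (s + t).
      by rewrite -[1](mulfV st) -mulrBl addrAC subrr add0r.
    rewrite !scalerBr scalerDr !scalerA !(mulrCA (s + t)) mulfV// !mulr1.
    by rewrite scalerDl opprD addrACA.
  - move=> t _ _ t0 [s [c [s0 Cc [-> ->]]]]; exists (t * s), c.
    by rewrite scalerA mulrA mulr_ge0// ltW.
have [|f [lf fle fK]] := mazur_orlicz (@sublinear_norm R X) cK.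
  move=> _ _ [s [c [s0 Cc [-> ->]]]].
  by rewrite normrZ ger0_norm// ler_wpM2l// Cr.
have [|h hf _] := dual_of_bounded lf ler01; first by move=> y; rewrite mul1r.
exists h, r; split=> // c Cc; rewrite hf; apply: fK.
by exists 1, c; rewrite scale1r mul1r.
Qed.

End FrechetBalls.

(** * Mazur intersection property and separability of the dual *)

Section MazurAsplund.
Context {R : realType} (X : completeNormedModType R).
Hypotheses (sX : smooth X) (finN : finite_set (nonfrechet_points X)).

Lemma smooth_finite_mazur_intersection : mazur_intersection X.
Proof.
move=> C C0 cC bC vC; apply/seteqP; split=> [c Cc B [_ CB]|z zB].
  exact: CB.
apply: contrapT => nCz.
have [f [r [r0 fr]]] := closed_convex_separation cC vC C0 nCz.
have [M M0 CM] : exists2 M : R, 0 < M & forall c, C c -> `|c - z| <= M.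
  have [M [Mreal CM]] := bC; exists (`|M| + 1 + `|z|).
    by rewrite ltr_wpDr// ltr_wpDl.
  move=> c Cc; apply: (le_trans (ler_normB _ _)); rewrite lerD2r.
  by apply: CM => //; rewrite (le_lt_trans (ler_norm _))// ltrDl.
have [c0 Cc0] := C0.
have f0 : f != 0.
  by apply/eqP => f0; have := fr c0 Cc0; rewrite f0 leNgt r0.
(* On [C - z], of norm at most [M], this tolerance costs at most [r / 2], so [k *: g] stays at least
   [r / 2] there. *)
have rM0 : 0 < r / (2 * M) by rewrite divr_gt0// mulr_gt0.
have [x [g [k [x1 fx Dg k0 kgf]]]] := frechet_duality_dense sX finN f0 rM0.
have gC c : C c -> r / (2 * k) <= g (c - z).
  move=> Cc; have := ler_dual (k *: g - f) (c - z); rewrite dualB dualZ.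
  have kgfM : `|k *: g - f| * `|c - z| <= r / 2.
    apply: (@le_trans _ _ (r / (2 * M) * M)); first by rewrite ler_pM// CM.
    by rewrite invfM mulrA divfK ?gt_eqF.
  move=> /le_trans/(_ kgfM); rewrite ler_norml => /andP[kg _].
  rewrite invfM mulrA ler_pdivrMr// mulrC.
  have := fr c Cc; move: kg; lra.
have d0 : 0 < r / (2 * k) by rewrite divr_gt0// mulr_gt0.
have d40 : 0 < r / (2 * k) / 4 by rewrite divr_gt0.
have [n n0 nM] := frechet_large_ball sX x1 fx Dg M0 d40.
(* With [delta = r / (2 * k)], points of [C] lie within [n - 3 delta / 4] of the centre
   [n *: x + z], while [z] is at distance [n]; [rho] lies strictly between. *)
pose rho := n - r / (2 * k) / 2.
have Crho c : C c -> `|n *: x - (c - z)| <= rho - r / (2 * k) / 4.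
  by move=> Cc; have := nM _ (CM c Cc); have := gC c Cc; rewrite /rho; lra.
have rho0 : 0 < rho.
  by have := Crho c0 Cc0; have := normr_ge0 (n *: x - (c0 - z)); lra.
have := zB (closed_ball (n *: x + z) rho).
rewrite closed_ballE//= /closed_ball_ /= addrK normrZ_gt0// x1 mulr1.
suff H : ~ n <= rho.
  apply: contra_not H; apply; split.
    by exists (n *: x + z), rho; rewrite closed_ballE.
  move=> c Cc /=; rewrite (_ : n *: x + z - c = n *: x - (c - z)).
    by apply: le_trans (Crho c Cc) _; lra.
  by rewrite opprB addrA.
by rewrite /rho; lra.
Qed.

Lemma smooth_finite_separable_dual : separable X -> separable (dual X).
Proof.
move=> [D [cD dD]].
have [d0 [_ Dd0]] : [set: X] `&` D !=set0 by apply: dD; [exists 0|exact: openT].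
(* Points of [D] need not have norm 1, so a pair [(d, n)] selects a functional supported at some
   unit vector within [1/(n+1)] of [d], whenever there is one. *)
pose P (dn : X * nat) (h : dual X) := exists2 x,
  `|x| = 1 & duality_map x h /\ `|x - dn.1| < dn.2.+1%:R^-1.
have /choice[h hP] (dn : X * nat) : exists h, (exists h', P dn h') -> P dn h.
  have [[h' Ph']|nP] := pselect (exists h', P dn h'); first by exists h'.
  by exists 0 => /nP.
pose E := [set (ratr q.1 : R) *: h q.2 |
  q in [set: rat] `*` (D `*` [set: nat])].
exists E; split.
  apply: sub_countable (card_image_le _ _) _.
  by apply: countableX => //; apply: countableX.
move=> O [f Of] oO.
have /nbhs_ballP[e /= e0 eO] : nbhs f O by exact: open_nbhs_nbhs.
(* The density statement concerns nonzero functionals; 0 belongs to [E] through the rational 0. *)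
have [f0|f0] := eqVneq f 0.
  exists 0; split; first by rewrite -f0.
  by exists (0, (d0, 0%N)) => //=; rewrite rmorph0 scale0r.
have e30 : 0 < e / 3 by rewrite divr_gt0.
have [x [g [c [x1 fx Dg c0 cg]]]] := frechet_duality_dense sX finN f0 e30.
have [q] : exists q : rat, ratr q \in `]c - e / 3, c + e / 3[.
  by apply: rat_in_itvoo; lra.
rewrite in_itv /= => /andP[q1 q2].
have k0 : 0 < `|ratr q : R| + 1 by rewrite ltr_wpDl.
(* The divisor [|q| + 1] absorbs the later multiplication by [q]. *)
have [d d_gt0 Hd] := frechet_smooth_delta fx Dg (divr_gt0 e30 k0).
have d20 : 0 < d / 2 by rewrite divr_gt0.
have [n _ /(_ n (leqnn n))/= nd] := near_infty_natSinv_lt (PosNum d20).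
have n0 : 0 < n.+1%:R^-1 :> R by rewrite invr_gt0.
have [y [xy Dy]] : ball x n.+1%:R^-1 `&` D !=set0.
  apply: dD; last exact: ball_open.
  by exists x; exact: ballxx.
have [|x' x'1 [Dx' x'y]] := hP (y, n).
  exists g, x => //; split; first by rewrite Dg.
  by move: xy; rewrite -ball_normE.
have hg : `|h (y, n) - g| < e / 3 / (`|ratr q : R| + 1).
  apply: (Hd x') => //.
  have -> : x - x' = (x - y) + (y - x') by rewrite addrA subrK.
  apply: (le_lt_trans (ler_normD _ _)).
  move: xy x'y nd; rewrite -ball_normE /= (distrC x').
  by move: (n.+1%:R^-1) => m; lra.
exists ((ratr q : R) *: h (y, n)); split; last by exists (q, (y, n)).
apply: eO; rewrite -ball_normE /= distrC.
(* Three errors of size [e / 3]: from [g] to the selected functional, from [c] to [q], and from [f]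
   to [c *: g]; the first is strict. *)
have -> : (ratr q : R) *: h (y, n) - f = (ratr q : R) *: (h (y, n) - g) +
    (((ratr q : R) - c) *: g + (c *: g - f)).
  by rewrite scalerBr scalerBl !addrA !subrK.
apply: (le_lt_trans (ler_normD _ _)).
have [g1 _] : duality_map x g by rewrite Dg.
have qhg : `|(ratr q : R) *: (h (y, n) - g)| < e / 3.
  rewrite normrZ.
  apply: (@le_lt_trans _ _ ((`|ratr q : R| + 1) * `|h (y, n) - g|)).
    by rewrite ler_wpM2r// lerDl.
  by rewrite -ltr_pdivlMl// mulrC.
have qcg : `|((ratr q : R) - c) *: g + (c *: g - f)| <= e / 3 + e / 3.
  apply: (le_trans (ler_normD _ _)); apply: lerD => //.
  rewrite normrZ (g1 : `|g| = 1) mulr1 ler_norml; apply/andP; split; lra.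
apply: (lt_le_trans (ltr_leD qhg qcg)); lra.
Qed.

End MazurAsplund.

Theorem theorem6 (R : realType) (X : completeNormedModType R)
    (hsmooth : smooth X) (hfin : finite_set (nonfrechet_points X)) :
  hereditary_mazur_intersection X /\ asplund X.
Proof.
split; [split; first exact: smooth_finite_mazur_intersection|] => Y.
  apply: smooth_finite_mazur_intersection.
    exact: smooth_subspace.
  exact: finite_nonfrechet_points_subspace.
apply: smooth_finite_separable_dual; first exact: smooth_subspace.
exact: finite_nonfrechet_points_subspace.
Qed.
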